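(* Consider the Bayesian game described in the context. Suppose that for $i\in N$, $u_i(a,\theta)$ is continuous over $\mathcal{A}\times\Theta$ and $u_i(a_i,a_{-i},\theta)$ is concave in $a_i$. Then, for every degree $d$, there exists $V^*=(v_1^*,\ldots,v_n^* )\in\mathcal{V}_d$ such that $$V^*\in\arg\max_{V=(v_1,\ldots,v_n)\in\mathcal{V}_d}\ \sum_{i=1}^n\mathbb{E}_\eta\big[u_i\big(v_i^T\xi_d(\theta_i),(v_{-i}^* )^T\xi_d(\theta_{-i}),\theta\big)\big].$$
   Context: There are $n$ players, $N=\{1,\ldots,n\}$. For each $i$, the type set $\Theta_i\subset\mathbb{R}$ and the action space $\mathcal{A}_i=[\underline{a}_i,\overline{a}_i]\subset\mathbb{R}$ are compact intervals. $\Theta=\Theta_1\times\cdots\times\Theta_n$, $\mathcal{A}=\mathcal{A}_1\times\cdots\times\mathcal{A}_n$; the subscript $-i$ denotes the vector over all players except $i$. Player $i$ has utility $u_i(a,\theta)=u_i(a_i,a_{-i},\theta)$. $\eta$ is the joint probability distribution of $\theta$ on $\Theta$ and $\mathbb{E}_\eta$ is expectation with respect to $\eta$. $\xi_d(t):=(1,t,t^2,\ldots,t^d)^T\in\mathbb{R}^{d+1}$; $v_{-i}^T\xi_d(\theta_{-i})$ denotes the vector $(v_j^T\xi_d(\theta_j))_{j\neq i}$. $\mathcal{V}_d:=\mathcal{V}_d^1\times\cdots\times\mathcal{V}_d^n$ where $$\mathcal{V}_d^i:=\{v_i\in\mathbb{R}^{d+1}:\ \underline{a}_i\le v_i^T\xi_d(\theta_i)\le\overline{a}_i,\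 \forall\theta_i\in\Theta_i\}.$$ *)

(* Defs.v *)
From mathcomp Require Import all_boot all_order all_algebra.
From mathcomp Require Import all_classical all_reals all_analysis.

Set Implicit Arguments.
Unset Strict Implicit.
Unset Printing Implicit Defensive.

Import Order.TTheory GRing.Theory Num.Theory.
Import numFieldNormedType.Exports.

Local Open Scope classical_set_scope.
Local Open Scope convex_scope.
Local Open Scope ring_scope.

(* [convex_function] of mathcomp-analysis with the inequality reversed. *)
Definition concave_function (R : numFieldType) (E : lmodType R)
    (E' := convex_lmodType E) (D : set E') (f : E' -> R^o) :=
  forall (t : {i01 R}),
    {in D &, forall (x y : E'), (f x <| t |> f y <= f (x <| t |> y))%R}.

Definition argmax (d : Order.disp_t) (S : porderType d) (T : Type)
    (D : set T) (f : T -> S) : set T :=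
  [set x | D x /\ forall y, D y -> (f y <= f x)%O].

Notation borel_rV R n := (g_sigma_algebraType (@open 'rV[R]_n)).

Section Game.
Variables (R : realType) (n : nat).

Definition box (lo hi : 'I_n -> R) : set 'rV[R]_n :=
  [set x | forall i, x 0 i \in `[lo i, hi i]].

(* The action profile (x, a_{-i}). *)
Definition deviate (i : 'I_n) (x : R) (a : 'rV[R]_n) : 'rV[R]_n :=
  \row_j (if j == i then x else a 0 j).

Definition xi (d : nat) (t : R) : 'cV[R]_d.+1 := \col_(k < d.+1) t ^+ k.

Definition strategy (d : nat) (v : 'cV[R]_d.+1) (t : R) : R :=
  (v^T *m xi d t) 0 0.

Definition actions (d : nat) (V : 'I_n -> 'cV[R]_d.+1) (theta : 'rV[R]_n) :
    'rV[R]_n :=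
  \row_j strategy (V j) (theta 0 j).

Definition admissible (tlo thi alo ahi : 'I_n -> R) (d : nat) :
    set ('I_n -> 'cV[R]_d.+1) :=
  [set V | forall i, forall t, t \in `[tlo i, thi i] ->
     alo i <= strategy (V i) t <= ahi i].

(* Utilities are only constrained on A x Theta, hence the extension of the
   integrand by zero outside Theta. *)
Definition expected_utility (eta : probability (borel_rV R n) R)
    (Theta : set 'rV[R]_n) (u : 'I_n -> 'rV[R]_n -> 'rV[R]_n -> R) (d : nat)
    (Vs : 'I_n -> 'cV[R]_d.+1) (i : 'I_n) (v : 'cV[R]_d.+1) : \bar R :=
  'E_eta[(fun theta : 'rV[R]_n =>
    u i (deviate i (strategy v (theta 0 i)) (actions Vs theta)) theta) \_ Theta].

End Game.

(* Main.v *)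
Require Import Defs.
From mathcomp Require Import all_boot all_order all_algebra zify.
From mathcomp Require finmap all_classical all_reals all_analysis lra.

(** An equilibrium in polynomial strategies is a point V of a convex set at
    which gain W V <= 0 for all W, where gain W V is the sum over the players
    of what a unilateral switch from V to W brings (the Nikaido-Isoda
    function).  It is continuous in V, concave in W and zero on the diagonal,
    so Ky Fan's minimax inequality ([ky_fan]) yields such a V on every compact
    convex set of profiles.  The three remaining points are the proof of
    Ky Fan's inequality, the regularity of the expected utilities, and
    compactness.

    Ky Fan's inequality is as strong as Brouwer's fixed point theorem, and a
    combinatorial parity argument is at its root.  Sperner's double counting
    ([sperner_parity]) is applied to Scarf's dominant sets: given linear orders
    indexed by I on a finite set, these sets behave like the simplices of a
    triangulation (every facet inside lies in two of them, see [inner_door]),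
    but no geometric subdivision has to be constructed.  For the lattice points
    of a simplex ordered by their coordinates, dominant sets are small
    ([grid_labelling]).  Given W_1, ..., W_m, a lattice point x stands for the
    convex combination V(x) of the W_j, and is labelled by a j that maximizes
    g W_j (V(x)).  At a point y supported by the labels seen nearby, all W_j
    with y_j > 0 nearly maximize g W_j (V(y)); this maximum is then at most
    g V(y) V(y) by quasi-concavity ([ky_fan_finite]).  Compactness passes from
    finite families of W to all of them.

    The utilities are uniformly continuous on the compact set A x Theta, and
    two strategies with close coefficients are uniformly close on Theta; hence
    the expected utilities are continuous in the coefficients ([payoff_unif]).
    Concavity of u_i in a_i passes to the integral ([payoff_concave]).

    Compactness is delicate only for a player whose type interval is a point.
    On a nondegenerate interval, the values at d+1 points determine the
    coefficients, so bounded strategies have bounded coefficients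
    ([coef_bound]); on a single point, infinitely many polynomials represent
    the same strategy and the admissible set is unbounded when d > 0.  Such
    players are restricted to constant polynomials ([reduced]), which changes
    no strategy on Theta ([admissible_reduce]), hence no payoff. *)

Set Implicit Arguments.
Unset Strict Implicit.
Unset Printing Implicit Defensive.

(** * Sperner's parity argument *)

Lemma odd_sum_eq (J : finType) (A : pred J) (f g : J -> nat) :
  (forall i, A i -> odd (f i) = odd (g i)) ->
  odd (\sum_(i | A i) f i) = odd (\sum_(i | A i) g i).
Proof.
by move=> fg; rewrite !(big_morph odd oddD (erefl _)); apply: eq_bigr.
Qed.

Section Sperner.
Variables (P I : finType) (c : P -> I) (k0 : I).

(** If S carries all labels, it does so bijectively, and only the vertex
    labelled k0 can be removed.  Otherwise, if some vertex can be removed, then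
    exactly one label is repeated, and the vertices to remove are the two that
    share it. *)
Lemma odd_doors_of_room (S : {set P}) : #|S| = #|I| ->
  odd #|[set x in S | c @: (S :\ x) == ~: [set k0]]| = (c @: S == setT).
Proof.
move=> cardS.
have cardk : #|~: [set k0]| = #|I|.-1 by rewrite cardsC1.
have cardD x : x \in S -> #|S :\ x| = #|I|.-1.
  by move=> xS; rewrite -cardS (cardsD1 x S) xS.
have doorinj x : x \in S -> c @: (S :\ x) == ~: [set k0] ->
    {in S :\ x &, injective c}.
  by move=> xS /eqP cx; apply/imset_injP; rewrite cx cardk cardD.
have [cS|cS] := eqVneq (c @: S) setT.
  have injS : {in S &, injective c}.
    by apply/imset_injP; rewrite cS cardS cardsT.
  have /imsetP[x0 x0S k0E] : k0 \in c @: S by rewrite cS inE.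
  suff -> : [set x in S | c @: (S :\ x) == ~: [set k0]] = [set x0].
    by rewrite cards1.
  apply/setP => x; rewrite !inE; apply/andP/eqP => [[xS /eqP cx]|->].
    apply/eqP/negPn/negP => xx0.
    have : k0 \in c @: (S :\ x).
      by rewrite k0E; apply: imset_f; rewrite !inE eq_sym xx0.
    by rewrite cx !inE eqxx.
  split=> //; rewrite eqEcard cardk card_in_imset ?cardD ?leqnn ?andbT//.
    apply/subsetP => _ /imsetP[z /setD1P[zx0 zS] ->]; rewrite !inE k0E.
    by apply: contra zx0 => /eqP /injS ->.
  by move=> a b /setD1P[_ aS] /setD1P[_ bS]; apply: injS.
have [->|[x1]] := set_0Vmem [set x in S | c @: (S :\ x) == ~: [set k0]].
  by rewrite cards0.
rewrite inE => /andP[x1S cx1].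
have imS : c @: S = c x1 |: c @: (S :\ x1) by rewrite -imsetU1 setD1K.
have cx1k : c x1 != k0.
  apply: contra cS => /eqP cx1k; rewrite imS cx1k (eqP cx1).
  by apply/eqP/setP => z; rewrite !inE orbN.
have /imsetP[x2 x2S cx12] : c x1 \in c @: (S :\ x1) by rewrite (eqP cx1) !inE.
move: (x2S) => /setD1P[x21 x2S'].
suff -> : [set x in S | c @: (S :\ x) == ~: [set k0]] = [set x1; x2].
  by rewrite cards2 eq_sym x21.
apply/setP => x; rewrite !inE; apply/andP/orP => [[xS cx]|].
  apply/orP/negPn/negP; rewrite negb_or => /andP[xx1 xx2].
  by have := x21; rewrite (doorinj x xS cx _ _ _ _ cx12) ?eqxx// !inE
     ?x1S ?x2S' ?andbT// eq_sym.
case=> /eqP -> //; split=> //.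
rewrite -(eqP cx1); apply/eqP/setP => z; apply/imsetP/imsetP => -[w].
  move=> /setD1P[wx2 wS] ->; have [->|wx1] := eqVneq w x1; first by exists x2.
  by exists w; rewrite // !inE wx1.
move=> /setD1P[wx1 wS] ->; have [->|wx2] := eqVneq w x2.
  by exists x1; rewrite // !inE eq_sym x21.
by exists w; rewrite // !inE wx2.
Qed.

(** Pairs (D, S) with D a door of S are counted in two ways.  A door D is a set
    whose labels are all labels but k0; it is a facet of S = x |: D. *)
Lemma sperner_parity (F : {set {set P}}) :
  (forall S, S \in F -> #|S| = #|I|) ->
  odd #|[set S in F | c @: S == setT]| =
  odd (\sum_(D : {set P} | c @: D == ~: [set k0])
         #|[set x | (x \notin D) && (x |: D \in F)]|).
Proof.
move=> cardF.
pose door (D : {set P}) := c @: D == ~: [set k0].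
transitivity (odd (\sum_(S in F) #|[set x in S | door (S :\ x)]|)).
  rewrite -sum1_card (eq_bigl (fun S => (S \in F) && (c @: S == setT))).
    rewrite big_mkcondr; apply: odd_sum_eq => S SF.
    by rewrite odd_doors_of_room ?cardF //; case: ifP.
  by move=> S; rewrite inE.
congr odd.
under eq_bigr do rewrite -sum1_card.
under [in RHS]eq_bigr do rewrite -sum1_card.
rewrite !pair_big_dep /=.
rewrite (reindex_onto
          (fun p : {set P} * P => (p.2 |: p.1, p.2))
          (fun p : {set P} * P => (p.1 :\ p.2, p.2))) /=; last first.
  by case=> S x /=; rewrite !inE => /andP[_ /andP[xS _]]; rewrite setD1K.
apply: eq_bigl => -[D x] /=; rewrite !inE eqxx /= xpair_eqE eqxx andbT.
have [xD|xD] /= := boolP (x \in D).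
  rewrite andbF; apply/negbTE/negP => /andP[_ /eqP DE].
  by move: xD; rewrite -DE !inE eqxx.
by rewrite (setU1K xD) eqxx andbT andbC.
Qed.

End Sperner.

(** * Scarf's dominant sets *)

Section Scarf.
Variables (P I : finType) (r : I -> P -> nat).
Hypothesis r_inj : forall i, injective (r i).

(** Scarf's domination condition.  Dominant sets form an abstract simplicial
    complex ([dominantS]). *)
Definition dominant (S : {set P}) :=
  [forall y, exists i, forall x in S, r i y <= r i x].

Definition least i (S : {set P}) (x : P) :=
  (x \in S) && [forall z in S, r i x <= r i z].

Lemma leastP i (S : {set P}) x :
  reflect (x \in S /\ forall z, z \in S -> r i x <= r i z) (least i S x).
Proof.
apply: (iffP andP) => -[xS h]; split=> //; first exact/forall_inP.
exact/forall_inP.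
Qed.

Lemma least_uniq i (S : {set P}) x y : least i S x -> least i S y -> x = y.
Proof.
move=> /leastP[xS hx] /leastP[yS hy]; apply: (@r_inj i).
by apply/eqP; rewrite eqn_leq hx ?hy.
Qed.

Lemma dominantP (S : {set P}) :
  reflect (forall y, exists i, forall x, x \in S -> r i y <= r i x)
          (dominant S).
Proof.
apply: (iffP forallP) => h y.
  by have /existsP[i /forall_inP hi] := h y; exists i.
by have [i hi] := h y; apply/existsP; exists i; apply/forall_inP.
Qed.

Lemma dominantS (S D : {set P}) : D \subset S -> dominant S -> dominant D.
Proof.
move=> /subsetP DS /dominantP h; apply/dominantP => y.
by have [i hi] := h y; exists i => x /DS /hi.
Qed.

(** The index given by dominance at y itself is one for which y is minimal; as
    distinct elements have distinct indices, dominant sets have at most #|I|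
    elements. *)
Lemma dominant_least (S : {set P}) y :
  dominant S -> y \in S -> exists i, least i S y.
Proof.
by move=> /dominantP h yS; have [i hi] := h y; exists i; apply/leastP.
Qed.

(** The analogue of the full-dimensional simplices of a triangulation. *)
Definition rooms : {set {set P}} :=
  [set S : {set P} | (#|S| == #|I|) && dominant S].

(** The elements e i play the vertices of a large simplex around all others:
    e i is the bottom of order i and lies above all inner points for the other
    orders.  There is at least one inner point, t0. *)
Variables (e : I -> P) (t0 : P).
Hypothesis e_least : forall i y, y != e i -> r i (e i) < r i y.
Hypothesis e_top : forall i j t,
  i != j -> t \notin codom e -> r i t < r i (e j).
Hypothesis t0e : t0 \notin codom e.

(** Since #|D| = #|I| - 1, sending an index to its minimum in D identifies
    exactly two indices i and j.  Any room x |: D is obtained by letting x take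
    over the role of one of these two: for k = i, j, the point x must beat the
    minima of D for all indices but k, and dominance forces it to be the
    largest such point for order k. *)
Lemma inner_door (D : {set P}) t : t \in D -> t \notin codom e ->
  #|D| = #|I|.-1 -> dominant D ->
  #|[set x | (x \notin D) && (x |: D \in rooms)]| = 2.
Proof.
move=> tD te cardD domD.
have I0 : 0 < #|I|.
  by case/dominantP/(_ t): domD => i _; apply/card_gt0P; exists i.
pose mu i := [arg min_(x < t | x \in D) r i x].
have muP i : least i D (mu i).
  by rewrite /mu; case: arg_minnP => // x xD hx; apply/leastP.
have muD i : mu i \in D by have /leastP[] := muP i.
have mu_le i z : z \in D -> r i (mu i) <= r i z.
  by have /leastP[_] := muP i; apply.
have mu_uniq i x : least i D x -> x = mu i.
  by move=> /least_uniq; apply.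
have mu_im : mu @: setT = D.
  apply/setP => x; apply/imsetP/idP => [[i _ ->]//|xD].
  by have [i /mu_uniq ->] := dominant_least domD xD; exists i.
have [i [j [ij muij]]] : exists i j, i != j /\ mu i = mu j.
  have ninj : ~ {in [set: I] &, injective mu}.
    move/card_in_imset; rewrite mu_im cardD cardsT.
    by move=> /eqP; rewrite -eqSS prednK // eqn_leq ltnn andbF.
  have : ~~ [forall i, forall j, (mu i == mu j) ==> (i == j)].
    apply/negP => /forallP h; apply: ninj => i j _ _ mij.
    by have /forallP/(_ j) := h i; rewrite mij eqxx => /eqP.
  rewrite negb_forall => /existsP[i]; rewrite negb_forall => /existsP[j].
  by rewrite negb_imply => /andP[/eqP mij nij]; exists i, j.
have mu_inj : {in [set~ j] &, injective mu}.
  apply/imset_injP; rewrite cardsC1 -cardD -mu_im; apply/eqP/eq_card => x.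
  apply/idP/idP => /imsetP[k _ ->]; first exact: imset_f.
  have [->|kj] := eqVneq k j; first by rewrite -muij imset_f // !inE.
  by rewrite imset_f // !inE.
have mu_eq k l : mu k = mu l -> k != l -> (k \in [set i; j]).
  rewrite !inE => kl nkl; have [->|kj] := eqVneq k j; first by rewrite orbT.
  rewrite orbF; have [lj|lj] := eqVneq l j.
    by apply/eqP/mu_inj; rewrite ?inE // kl lj.
  by move: nkl; rewrite (mu_inj k l) ?inE ?eqxx.
have mu_twin k : k \in [set i; j] -> exists2 l, l != k & mu l = mu k.
  by rewrite !inE => /orP[]/eqP->; [exists j; rewrite // eq_sym|exists i].
(* The candidates for the vertex that takes over the role of k. *)
pose Y k := [set y | [forall l, (l != k) ==> (r l (mu l) < r l y)]].
have YP k y : reflect (forall l, l != k -> r l (mu l) < r l y) (y \in Y k).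
  rewrite inE; apply: (iffP forallP) => h l; last exact/implyP/h.
  by apply/implyP.
have Ye k : e k \in Y k.
  apply/YP => l lk; apply: leq_ltn_trans (mu_le l _ tD) _.
  exact: e_top.
pose s k := [arg max_(x > e k | x \in Y k) r k x].
have sY k : s k \in Y k by rewrite /s; case: arg_maxnP.
have s_max k y : y \in Y k -> r k y <= r k (s k).
  by rewrite /s; case: arg_maxnP => // x _; apply.
have s_notin k : k \in [set i; j] -> s k \notin D.
  move=> kij; apply/negP => sD.
  have [l /mu_uniq sE] := dominant_least domD sD.
  have [l' l'k mul'] := mu_twin k kij.
  have /YP h := sY k.
  have [lk|lk] := eqVneq l k.
    by have := h l' l'k; rewrite mul' sE lk ltnn.
  by have := h l lk; rewrite -sE ltnn.
have s_lt k : k \in [set i; j] -> r k (s k) < r k (mu k).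
  move=> kij; have /dominantP/(_ (s k))[l hl] := domD.
  have [lk|lk] := eqVneq l k; last first.
    have /YP/(_ l lk) lts := sY k.
    by have := hl _ (muD l); rewrite leqNgt lts.
  subst l; rewrite ltn_neqAle hl // andbT.
  by apply: contraNneq (s_notin k kij) => /r_inj ->.
have s_room k : k \in [set i; j] -> s k |: D \in rooms.
  move=> kij; rewrite inE cardsU1 s_notin// cardD.
  apply/andP; split; first by lia.
  apply/dominantP => y; have [yY|/YP yY] := boolP (y \in Y k).
    exists k => x /setU1P[->|xD]; first exact: s_max.
    apply: leq_trans (s_max k y yY) _.
    by apply/ltnW/(leq_trans (s_lt k kij))/mu_le.
  have /existsP[l /andP[lk ly]] : [exists l, (l != k) && (r l y <= r l (mu l))].
    apply: contra_notT yY => /existsPn h l lk.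
    by have := h l; rewrite lk /= -ltnNge.
  exists l => x /setU1P[->|xD].
    by apply: leq_trans ly _; apply/ltnW; have /YP := sY k; apply.
  exact: leq_trans ly (mu_le _ _ xD).
have sij : s i != s j.
  apply/eqP => sE; have := s_lt i; rewrite sE !inE eqxx => /(_ erefl).
  by have /YP/(_ i ij) := sY j; lia.
suff -> : [set x | (x \notin D) && (x |: D \in rooms)] = s @: [set i; j].
  by rewrite imsetU1 imset_set1 cards2 sij.
apply/setP => x; rewrite inE; apply/andP/imsetP; last first.
  by move=> [k kij ->]; rewrite s_notin// s_room.
move=> [xD]; rewrite inE => /andP[_ domx].
have [k /leastP[_ xk]] := dominant_least domx (setU11 x D).
have xk' : r k x < r k (mu k).
  rewrite ltn_neqAle xk ?inE ?muD ?orbT// andbT.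
  by apply: contraNneq xD => /r_inj ->; exact: muD.
(* Each element of D remains minimal in x |: D for some index, where it
   strictly precedes x; so x is minimal for k alone, and k cannot have been
   the only index of its minimum in D. *)
have own z : z \in D -> exists2 l, z = mu l & r l z < r l x.
  move=> zD; have [l /leastP[_ zl]] := dominant_least domx (setU1r x zD).
  exists l.
    apply: mu_uniq; apply/leastP; split=> // w wD.
    by apply: zl; rewrite inE wD orbT.
  rewrite ltn_neqAle zl ?setU11 // andbT.
  by apply: contraNneq xD => /r_inj <-.
have kij : k \in [set i; j].
  have [l kl lx] := own _ (muD k).
  by apply: mu_eq kl _; apply: contraTneq lx => <-; rewrite -leqNgt ltnW.
exists k => //; apply: (@r_inj k); apply/eqP.
have xY : x \in Y k.
  apply/YP => l lk; have [l' ll' l'x] := own _ (muD l).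
  have [ll|nll'] := eqVneq l l'; first by move: l'x; rewrite -ll.
  have l'k : l' != k.
    by apply: contraTneq l'x => ->; rewrite -leqNgt xk// inE muD orbT.
  have lij := mu_eq _ _ ll' nll'.
  have l'ij : l' \in [set i; j] by apply: mu_eq (esym ll') _; rewrite eq_sym.
  move: kij nll' lk l'k lij l'ij; rewrite !inE.
  by move=> /orP[]/eqP-> nll' lk l'k /orP[]/eqP lE /orP[]/eqP l'E;
    rewrite ?lE ?l'E ?eqxx in nll' lk l'k.
rewrite eqn_leq s_max//=.
have /dominantP/(_ (s k))[l hl] := domx.
have [lk|lk] := eqVneq l k; first by subst l; apply: hl; rewrite setU11.
have /YP/(_ l lk) lts := sY k.
by have := hl (mu l); rewrite leqNgt lts inE muD orbT => /(_ erefl).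
Qed.

(** Only points outside the image of e can complete this door, because the set
    of all e i is not dominant (t0 beats all its minima).  A point outside
    beats e i for every i != k, so it can only be dominated through order k:
    the completing point is the largest one for that order. *)
Lemma boundary_door k (D : {set P}) : D = e @: [set~ k] ->
  #|[set x | (x \notin D) && (x |: D \in rooms)]| = 1.
Proof.
have ne t i : t \notin codom e -> t != e i.
  by apply: contraNneq => ->; exact: codom_f.
have e_inj : injective e.
  move=> i j eij; apply/eqP/negPn/negP => ij.
  by have := e_top ij t0e; rewrite -eij ltnNge ltnW// e_least // ne.
move=> DE; have cardD : #|D| = #|I|.-1 by rewrite DE card_imset // cardsC1.
have I0 : 0 < #|I| by apply/card_gt0P; exists k.
have eD i : i != k -> e i \in D by move=> ik; rewrite DE imset_f // !inE.
have DP x : x \in D -> exists2 i, i != k & x = e i.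
  by rewrite DE => /imsetP[i]; rewrite !inE => ik ->; exists i.
pose s := [arg max_(x > t0 | x \notin codom e) r k x].
have [se s_max] : s \notin codom e /\
    forall x, x \notin codom e -> r k x <= r k s.
  by rewrite /s; case: arg_maxnP.
have sD : s \notin D by apply: contra se => /DP[i _ ->]; exact: codom_f.
suff -> : [set x | (x \notin D) && (x |: D \in rooms)] = [set s].
  by rewrite cards1.
apply/setP => x; rewrite !inE; apply/andP/eqP => [[xD /andP[_ domx]]|->].
  have xe : x \notin codom e.
    apply/negP => /codomP[i xE]; subst x.
    have [ik|ik] := eqVneq i k; last by rewrite eD in xD.
    subst i; have /dominantP/(_ t0)[i hi] := domx.
    have : r i t0 <= r i (e i).
      by apply: hi; have [->|ik] := eqVneq i k; rewrite ?setU11// inE eD ?orbT.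
    by rewrite leqNgt e_least // ne.
  apply: (@r_inj k); apply/eqP; rewrite eqn_leq s_max//=.
  have /dominantP/(_ s)[i hi] := domx.
  have [ik|ik] := eqVneq i k; first by subst i; apply: hi; rewrite setU11.
  have := hi (e i); rewrite inE eD// orbT leqNgt e_least ?ne//.
  by move=> /(_ isT).
rewrite sD cardsU1 sD cardD add1n prednK// eqxx; split=> //=.
apply/dominantP => y; have [/codomP[i ->]|ye] := boolP (y \in codom e).
  exists i => z _; have [->//|zi] := eqVneq z (e i); exact/ltnW/e_least.
exists k => z /setU1P[->|/DP[i ik ->]]; first exact: s_max.
by apply/ltnW/e_top => //; rewrite eq_sym.
Qed.

(** The door made of the e i with i != k0 is the only one contained in the
    image of e that bears the right labels; it lies in one room and all others
    lie in an even number of rooms, so the number of fully labelled rooms is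
    odd. *)
Theorem scarf (c : P -> I) (k0 : I) : (forall i, c (e i) = i) ->
  exists2 S, S \in rooms & c @: S = setT.
Proof.
move=> ce.
suff : odd #|[set S in rooms | c @: S == setT]|.
  have [->|[S]] := set_0Vmem [set S in rooms | c @: S == setT].
    by rewrite cards0.
  by rewrite inE => /andP[Sr /eqP cS] _; exists S.
rewrite (sperner_parity c k0); last by move=> S; rewrite inE => /andP[/eqP].
have cD : c @: (e @: [set~ k0]) == ~: [set k0].
  rewrite -imset_comp (eq_imset _ ce) imset_id.
  by apply/eqP/setP => i; rewrite !inE.
rewrite (bigD1 (e @: [set~ k0])) //= (boundary_door (erefl _)) oddD /=.
rewrite (@odd_sum_eq _ _ _ (fun=> 0)) ?big1 // => D /andP[cD' DE].
have [->|[x]] := set_0Vmem [set x | (x \notin D) && (x |: D \in rooms)].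
  by rewrite cards0.
rewrite !inE => /andP[xD /andP[cardx domx]].
have cardD : #|D| = #|I|.-1.
  by move: cardx; rewrite cardsU1 xD add1n => /eqP <-.
have [/existsP[t /andP[tD te]]|h] :=
  boolP [exists t, (t \in D) && (t \notin codom e)].
  rewrite (inner_door tD te cardD) //; exact: dominantS (subsetUr _ _) domx.
case/negP: DE; rewrite eqEcard cardD.
have De x' : x' \in D -> exists i, x' = e i.
  move=> x'D; apply/codomP/negPn/negP => xe.
  case/negP: h; apply/existsP; exists x'.
  by rewrite x'D xe.
apply/andP; split; last first.
  by rewrite (leq_trans (leq_imset_card _ _))// cardsC1.
apply/subsetP => y yD; have [i yE] := De y yD.
rewrite yE imset_f //; have : c y \in c @: D by apply: imset_f.
by rewrite (eqP cD') yE ce.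
Qed.

End Scarf.

(** * Labellings of the lattice points of a simplex *)

Section Grid.
Variables (m N : nat).

(** Lattice points of the simplex, scaled by N. *)
Definition grid := {x : {ffun 'I_m -> 'I_N.+1} | \sum_i x i == N}.

Definition gcoord (x : grid) (i : 'I_m) : nat := sval x i.

Lemma gcoord_sum x : \sum_i gcoord x i = N.
Proof. by apply/eqP; exact: (svalP x). Qed.

Lemma gcoord_le x i : gcoord x i <= N.
Proof. by rewrite /gcoord -ltnS. Qed.

(** Room left below the sum N can be spent on any one coordinate. *)
Lemma grid_dump (mu : 'I_m -> nat) i0 : \sum_i mu i <= N ->
  exists x, forall i, gcoord x i = mu i + (i == i0) * (N - \sum_i mu i).
Proof.
move=> muN; pose h i := mu i + (i == i0) * (N - \sum_i mu i).
have hN : \sum_i h i = N.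
  rewrite big_split /= -big_distrl /= [X in _ + X * _](_ : _ = 1) ?mul1n.
    by rewrite subnKC.
  by rewrite (bigD1 i0)//= eqxx big1 // => i /negbTE ->.
have hle i : h i < N.+1 by rewrite ltnS -hN (bigD1 i) //= leq_addr.
have hP : \sum_i [ffun i => Ordinal (hle i)] i == N.
  by apply/eqP; rewrite -[RHS]hN; apply: eq_bigr => i _; rewrite ffunE.
exists (exist (fun x : {ffun 'I_m -> 'I_N.+1} => \sum_i x i == N) _ hP) => i.
  by rewrite /gcoord /= ffunE.
Qed.

(** Coordinate i, with ties broken by enumeration so that the order is strict;
    [inr i] is put at the bottom of order i and the other [inr j] at the top. *)
Definition grank (i : 'I_m) (p : grid + 'I_m) : nat :=
  match p with
  | inl x => (gcoord x i * #|{: grid}| + enum_rank x).+1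
  | inr j => if j == i then 0 else (N.+1 * #|{: grid}| + j).+1
  end.

Lemma grank_inl_le i x z :
  grank i (inl x) <= grank i (inl z) -> gcoord x i <= gcoord z i.
Proof.
rewrite /= ltnS => h; rewrite leqNgt; apply/negP => zx; move: h.
apply/negP; rewrite -ltnNge.
apply: (@leq_trans ((gcoord z i).+1 * #|{: grid}|)).
  by rewrite mulSn addnC ltn_add2r ltn_ord.
by apply: leq_trans (leq_addr _ _); rewrite leq_mul2r zx orbT.
Qed.

Lemma grank_lt_top i x j : j != i -> grank i (inl x) < grank i (inr j).
Proof.
move=> /= /negbTE ->; rewrite ltnS.
apply: (@leq_trans (N.+1 * #|{: grid}|)); last by rewrite leq_addr.
apply: (@leq_trans ((gcoord x i).+1 * #|{: grid}|)).
  by rewrite mulSn addnC ltn_add2r ltn_ord.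
by rewrite leq_mul2r ltnS gcoord_le orbT.
Qed.

Lemma grank_inj i : injective (grank i).
Proof.
move=> [x|j] [z|k].
- move=> /[dup] xz [h]; congr inl; apply: enum_rank_inj; apply: val_inj.
  have : gcoord x i = gcoord z i.
    by apply/eqP; rewrite eqn_leq; apply/andP; split;
      apply: grank_inl_le; rewrite xz.
  by move: h => /[swap] -> /addnI.
- have [->|ki] := eqVneq k i; first by rewrite /= eqxx.
  by move=> h; have := grank_lt_top x ki; rewrite h ltnn.
- have [->|ki] := eqVneq j i; first by rewrite /= eqxx.
  by move=> h; have := grank_lt_top z ki; rewrite h ltnn.
- rewrite /=; case: (eqVneq j i) => [->|ji]; case: (eqVneq k i) => [->|ki] //.
  by move=> [] /addnI /val_inj ->.
Qed.

(** A fully labelled dominant set, minus its vertices at infinity, is a set of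
    lattice points that carries the labels i with [inr i] absent.  Let mu be
    the vector of its minimal coordinates for these labels, and 0 elsewhere.
    If mu summed to at most N - m, then mu + 1 would fit below a lattice point
    that contradicts dominance; so all points of the set, and the point y
    obtained by completing mu on a present label, exceed mu by at most m. *)
Theorem grid_labelling (c : grid -> 'I_m) : 0 < m ->
  exists y : grid, forall i, 0 < gcoord y i ->
    exists2 x, c x = i & forall k, gcoord x k <= gcoord y k + m /\
                                   gcoord y k <= gcoord x k + m.
Proof.
move=> m0; pose k0 := Ordinal m0.
have [|t0 _] := @grid_dump (fun=> 0) k0; first by rewrite big1.
pose c' (p : grid + 'I_m) :=
  match p with inl x => c x | inr i => i end.
have inl_notin (t : grid) : inl t \notin codom (inr : 'I_m -> grid + 'I_m).
  by apply/negP => /codomP[].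
have [] := @scarf _ _ grank grank_inj inr (inl t0) _ _ (inl_notin t0) c' k0.
- move=> i [x|j] ji /=; rewrite eqxx //.
  by case: (eqVneq j i) => // ij; move: ji; rewrite ij eqxx.
- move=> i j [t|k] ij; last by move=> /negP[]; exact: codom_f.
  by move=> _; apply: grank_lt_top; rewrite eq_sym.
- by [].
move=> S; rewrite inE => /andP[/eqP cardS domS] cS.
have sur i : inr i \notin S -> exists2 x, inl x \in S & c x = i.
  move=> iS; have /imsetP[[x xS ->|j jS ij]] : i \in c' @: S by rewrite cS inE.
    by exists x.
  by rewrite ij jS in iS.
have [i0 i0S] : exists i, inr i \notin S.
  apply/existsP; rewrite -negb_forall; apply/negP => /forallP h.
  have /dominantP/(_ (inl t0))[i hi] := domS.
  by have := hi _ (h i); rewrite /= eqxx.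
have [x0 x0S _] := sur i0 i0S.
pose mu i := if inr i \in S then 0 else
  gcoord [arg min_(x < x0 | inl x \in S) gcoord x i] i.
have mu_le x i : inl x \in S -> mu i <= gcoord x i.
  rewrite /mu; case: ifP => // _ xS; case: arg_minnP => // z zS; exact.
have mu_wit i : inr i \notin S -> exists2 x, inl x \in S & mu i = gcoord x i.
  rewrite /mu => /negbTE ->; case: arg_minnP => // x xS _; by exists x.
have muN : \sum_i mu i <= N.
  by rewrite -[leqRHS](gcoord_sum x0); apply: leq_sum => i _; exact: mu_le.
have Nmu : N < \sum_i mu i + m.
  rewrite ltnNge; apply/negP => h.
  have [|z zE] := @grid_dump (fun i => (mu i).+1) i0.
    by under eq_bigr do rewrite -addn1; rewrite big_split /= sum1_card card_ord.
  have /dominantP/(_ (inl z))[i hi] := domS.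
  have [iS|iS] := boolP (inr i \in S).
    by have := hi _ iS; rewrite /= eqxx.
  have [x xS mux] := mu_wit i iS.
  have /grank_inl_le := hi _ xS; rewrite zE -mux; lia.
have mu_ge x i : inl x \in S -> gcoord x i <= mu i + m.
  move=> xS; rewrite leqNgt; apply/negP => h.
  have : \sum_j mu j + m < \sum_j gcoord x j.
    rewrite (bigD1 i) //= [ltnRHS](bigD1 i) //=.
    rewrite addnAC -addSn; apply: leq_add => //.
    by apply: leq_sum => j _; exact: mu_le.
  by rewrite gcoord_sum ltnNge ltnW.
have [y yE] := grid_dump i0 muN.
exists y => i; rewrite yE => yi.
have iS : inr i \notin S.
  apply/negP => iS; move: yi; rewrite /mu iS.
  by have [ii0|] := eqVneq i i0; rewrite // ii0 (negbTE i0S) in iS.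
have [x xS cx] := sur i iS; exists x => // k.
have := mu_le x k xS; have := mu_ge x k xS; rewrite yE.
clear -muN Nmu; move: (mu k) (gcoord x k) muN Nmu => a b.
move: (\sum_i mu i) => s.
by case: (k == i0) => /=; lia.
Qed.

End Grid.

Import finmap all_classical all_reals all_analysis lra.
Import Order.TTheory GRing.Theory Num.Theory.
Import numFieldNormedType.Exports.

Local Open Scope classical_set_scope.
Local Open Scope ring_scope.

(** * Ky Fan's minimax inequality *)

(** Heine-Cantor, for the compact subset A of a space.  It is stated with a
    filter on the modulus d so that finitely many functions can share it. *)
Lemma compact_unif_continuous (R : realType) (T : pseudoMetricType R)
    (A : set T) (f : T -> R) (e : R) :
  compact A -> {within A, continuous f} -> 0 < e ->
  \forall d \near 0^'+, forall x y,
    A x -> A y -> ball x d y -> `|f x - f y| < e.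
Proof.
move=> /compact_near_coveringP/near_covering_withinP cA.
move=> /subspace_continuousP fA e0.
suff : \forall d \near 0^'+,
    A `<=` [set x | forall y, A y -> ball x d y -> `|f x - f y| < e].
  by apply: filterS => d h x y Ax; apply: h.
apply: cA => x Ax.
have e20 : 0 < e / 2 by rewrite divr_gt0.
have := fA x Ax; move=> /cvgrPdist_lt/(_ _ e20).
rewrite near_withinE => /nbhs_ballP[r /= r0 hr].
have r20 : 0 < r / 2 by rewrite divr_gt0.
exists (ball x (r / 2), [set d | d < r / 2]) => /=.
  split; first exact: nbhsx_ballx.
  exact: nbhs_right_lt.
move=> [x' d] /= [xx' dr] Ax' y Ay x'y.
have fx' : `|f x - f x'| < e / 2.
  apply: hr => //; apply: le_ball xx'.
  by rewrite ler_pdivrMr// ler_peMr ?ler1n// ltW.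
have fy : `|f x - f y| < e / 2.
  apply: hr => //; apply: ball_split xx' _; exact: le_ball (ltW dr) _ x'y.
rewrite (splitr e) -(subrKA (f x)) (le_lt_trans (ler_normD _ _))//.
by rewrite ltrD// distrC.
Qed.

Lemma convex_combination (R : realType) (E : lmodType R) (A : set E)
    (m : nat) (W : 'I_m -> E) (x : 'I_m -> R) :
  @convex_set R E A -> (forall i, 0 <= x i) -> \sum_i x i = 1 ->
  (forall i, 0 < x i -> A (W i)) -> A (\sum_i x i *: W i).
Proof.
move=> cA; elim: m W x => [|m IH] W x x0 x1 xA.
  by move: x1; rewrite big_ord0 => /esym/eqP; rewrite oner_eq0.
rewrite big_ord_recl; move: x1; rewrite big_ord_recl => x1.
have rest0 : 0 <= \sum_(i < m) x (lift ord0 i) by apply: sumr_ge0.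
have [s0|s0] := eqVneq (\sum_(i < m) x (lift ord0 i)) 0.
  have z i : x (lift ord0 i) = 0 by apply: (psumr_eq0P _ s0).
  rewrite big1 ?addr0 => [|i _]; last by rewrite z scale0r.
  have x01 : x ord0 = 1 by rewrite -x1 s0 addr0.
  by rewrite x01 scale1r; apply: xA; rewrite x01.
have sp : 0 < \sum_(i < m) x (lift ord0 i) by rewrite lt_def s0.
set s := \sum_(i < m) _ in x1 rest0 s0 sp.
have restA : A (\sum_(i < m) (x (lift ord0 i) / s) *: W (lift ord0 i)).
  apply: IH => [i||i]; first by rewrite divr_ge0.
    by rewrite -mulr_suml divff.
  by rewrite pmulr_lgt0 ?invr_gt0 //; exact: xA.
have -> : \sum_(i < m) x (lift ord0 i) *: W (lift ord0 i) =
    s *: \sum_(i < m) (x (lift ord0 i) / s) *: W (lift ord0 i).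
  by rewrite scaler_sumr; apply: eq_bigr => i _; rewrite scalerA mulrC divfK.
have [x00|x00] := eqVneq (x ord0) 0.
  by move: restA; rewrite x00 add0r in x1; rewrite x00 scale0r add0r x1 scale1r.
have xp : 0 < x ord0 by rewrite lt_neqAle eq_sym x00 x0.
have x0le : x ord0 <= 1 by rewrite -x1 lerDl.
have := cA _ _ (Itv01 (ltW xp) x0le) (mem_set (xA _ xp)) (mem_set restA).
rewrite inE; congr A => /=.
have -> : s = 1 - x ord0 by rewrite -x1 addrAC subrr add0r.
by [].
Qed.

Section KyFan.
Context {R : realType} {E : normedModType R}.
Variables (K : set E) (g : E -> E -> R).
Hypothesis K_compact : compact K.
Hypothesis K_convex : @convex_set R E K.
Hypothesis g_cont : forall W, K W -> {within K, continuous g W}.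
Hypothesis g_quasiconcave :
  forall V c, K V -> @convex_set R E [set W | K W /\ c <= g W V].
Hypothesis g_diag : forall V, K V -> g V V <= 0.

(** [V] realizes lattice points as convex combinations of the W j.  The mesh
    1/N is chosen so that points at lattice distance m have images within the
    modulus d of uniform continuity. *)
Lemma ky_fan_finite (m : nat) (W : 'I_m -> E) (e : R) : (0 < m)%N -> 0 < e ->
  (forall j, K (W j)) -> exists2 V, K V & forall j, g (W j) V <= e.
Proof.
move=> m0 e0 KW; have e20 : 0 < e / 2 by rewrite divr_gt0.
have [d [d0 unif]] : exists d : R, 0 < d /\ forall j x y, K x -> K y ->
    `|x - y| < d -> `|g (W j) x - g (W j) y| < e / 2.
  have h : \forall d \near (0:R)^'+, forall j, forall x y,
      K x -> K y -> ball x d y -> `|g (W j) x - g (W j) y| < e / 2.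
    apply: filter_forall => j.
    exact: compact_unif_continuous K_compact (g_cont (KW j)) e20.
  have [d [d0 dh]] := filter_ex (filterI (@nbhs_right_gt R 0) h).
  by exists d; split => // j x y Kx Ky xy; apply: dh => //; rewrite -ball_normE.
pose w := \sum_j `|W j|.
have w0 : 0 <= w by apply: sumr_ge0.
have [N [N0 Nd]] : exists N, (0 < N)%N /\ m%:R * w < N%:R * d.
  exists (Num.bound (m%:R * w / d)).+1; split => //.
  rewrite -ltr_pdivrMr //; apply: lt_trans (archi_boundP _) _; last first.
    by rewrite ltr_nat.
  by rewrite divr_ge0 ?mulr_ge0 // ltW.
have NR0 : 0 < N%:R :> R by rewrite ltr0n.
pose V (x : grid m N) : E := \sum_k ((gcoord x k)%:R / N%:R) *: W k.
have Vcomb x A : @convex_set R E A ->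
    (forall k, (0 < gcoord x k)%N -> A (W k)) -> A (V x).
  move=> cA h; apply: convex_combination => [//|k||k].
  - by rewrite divr_ge0.
  - by rewrite -mulr_suml -natr_sum gcoord_sum divff // gt_eqF.
  - by rewrite pmulr_lgt0 ?invr_gt0 // ltr0n; exact: h.
have KV x : K (V x) by apply: Vcomb.
have Vclose x y : (forall k, (gcoord x k <= gcoord y k + m)%N /\
    (gcoord y k <= gcoord x k + m)%N) -> `|V x - V y| < d.
  move=> xy; rewrite -sumrB; apply: le_lt_trans (ler_norm_sum _ _ _) _.
  apply: (@le_lt_trans _ _ (\sum_k (m%:R / N%:R) * `|W k|)).
    apply: ler_sum => k _; rewrite -scalerBl normrZ ler_wpM2r //.
    rewrite -mulrBl normrM (@ger0_norm _ N%:R^-1) ?invr_ge0 //.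
    rewrite ler_wpM2r ?invr_ge0 //; have [xyk yxk] := xy k.
    by rewrite ler_norml lerBlDl lerNl opprB lerBlDl -!natrD !ler_nat xyk yxk.
  by rewrite -mulr_sumr mulrAC ltr_pdivrMr // [ltRHS]mulrC.
(* With best responses as labels, those seen near y are nearly optimal at y. *)
have [c cP] : exists c : grid m N -> 'I_m,
    forall x j, g (W j) (V x) <= g (W (c x)) (V x).
  suff /choice[c cP] : forall x, exists c, forall j,
      g (W j) (V x) <= g (W c) (V x) by exists c.
  move=> x; pose h j := g (W j) (V x).
  have [//|i _ hi] := @Order.TotalTheory.arg_maxP _ _ _ (Ordinal m0) xpredT h.
  by exists i => j; exact: hi.
have [y yP] := grid_labelling c m0.
exists (V y) => // j.
have [] := Vcomb y [set W' | K W' /\ g (W j) (V y) - e <= g W' (V y)].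
- exact: g_quasiconcave.
- move=> k /yP[x cx /Vclose xy]; split => //.
  have := unif j _ _ (KV x) (KV y) xy; have := unif k _ _ (KV x) (KV y) xy.
  have := cP x j; rewrite cx !ltr_norml; lra.
- by move=> _; have := g_diag (KV y); lra.
Qed.

(** The sets of V with g W V <= e, for W in K and e > 0, are closed and have the
    finite intersection property by [ky_fan_finite]. *)
Theorem ky_fan : K !=set0 -> exists2 V, K V & forall W, K W -> g W V <= 0.
Proof.
move=> [V0 KV0].
pose D : set (E * R) := [set p | K p.1 /\ 0 < p.2].
pose f (p : E * R) := [set V | K V /\ g p.1 V <= p.2].
have := K_compact; rewrite compact_In0 => /(_ _ D f) [].
- have /choice[h hP] : forall p, exists F, D p -> closed F /\ f p = K `&` F.
    move=> p; have [Dp|nDp] := pselect (D p); last by exists set0.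
    have := g_cont Dp.1 => /continuous_closedP.
    move=> /(_ [set r | r <= p.2] (@closed_le _ _)).
    move=> /closed_subspaceP[F cF FE]; exists F => _; split=> //.
    apply/seteqP; split => V /=.
      move=> [KV gV]; split=> //.
      have : (F `&` K) V by rewrite FE.
      by case.
    move=> [KV FV]; have : (F `&` K) V by [].
    by rewrite FE => -[].
  by exists h => p /hP[].
- move=> D' D'D.
  have [->|/fset0Pn[p0 p0D']] := eqVneq D' fset0.
    by exists V0 => p; rewrite /= in_fset0.
  have m0 : (0 < size D')%N.
    rewrite lt0n size_eq0; apply/eqP => h.
    by move: p0D'; rewrite -[_ \in _]/(p0 \in enum_fset D') h.
  have nthD (j : 'I_(size D')) : D (nth p0 D' j).
    by apply/set_mem/D'D; rewrite mem_nth.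
  have [e [e0 eh]] : exists e : R, 0 < e /\
      forall j : 'I_(size D'), e <= (nth p0 D' j).2.
    have h : \forall e \near (0:R)^'+,
        forall j : 'I_(size D'), e <= (nth p0 D' j).2.
      by apply: filter_forall => j; apply: nbhs_right_le; exact: (nthD j).2.
    by have [e [e0 eh]] := filter_ex (filterI (@nbhs_right_gt R 0) h); exists e.
  have [V KV hV] := ky_fan_finite m0 e0 (fun j => (nthD j).1).
  exists V => p /= pD'; split => //.
  have pj : (index p D' < size D')%N by rewrite index_mem.
  have := hV (Ordinal pj); have := eh (Ordinal pj); rewrite /= nth_index //.
  by move=> /[swap]; exact: le_trans.
- move=> V hV; exists V; first by have [] := hV (V0, 1); [split|].
  move=> W KW; apply/ler_addgt0Pl => e e0; rewrite addr0.
  by have [] := hV (W, e); [split|].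
Qed.

End KyFan.

(** * Boxes of types and actions *)

Section Boxes.
Context {R : realType} {n : nat}.
Implicit Types lo hi : 'I_n -> R.

Lemma box_compact lo hi : compact (box lo hi).
Proof.
apply: (@rV_compact _ _ (fun i => `[lo i, hi i]%classic)) => i.
exact: segment_compact.
Qed.

Lemma box_closed lo hi : closed (box lo hi).
Proof.
by apply: compact_closed; [exact: norm_hausdorff|exact: box_compact].
Qed.

Lemma box_measurable lo hi : measurable (box lo hi : set (borel_rV R n)).
Proof.
rewrite -[box lo hi]setCK; apply: measurableC; apply: sub_sigma_algebra.
exact/closed_openC/box_closed.
Qed.

Lemma within_continuous_measurable (D : set 'rV[R]_n) (f : 'rV[R]_n -> R) :
  measurable (D : set (borel_rV R n)) -> {within D, continuous f} ->
  measurable_fun (D : set (borel_rV R n)) (f : borel_rV R n -> R).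
Proof.
move=> mD /continuousP cf.
apply: (measurability _ (measurable_realfun.RGenOpens.measurableE R)).
move=> _ [_ [a [b ->] <-]].
have /cf/open_subspaceP[U oU UE] : open `]a, b[%classic by exact: interval_open.
rewrite setIC -UE.
by apply: measurableI => //; exact: sub_sigma_algebra.
Qed.

End Boxes.

(** * Polynomial strategies *)

Section Strategies.
Context {R : realType} {d : nat}.
Implicit Types (v : 'cV[R]_d.+1) (t : R).

Lemma strategyE v t : strategy v t = \sum_k v k 0 * t ^+ k.
Proof. by rewrite /strategy !mxE; apply: eq_bigr => k _; rewrite !mxE. Qed.

Lemma strategyD v w t : strategy (v + w) t = strategy v t + strategy w t.
Proof. by rewrite /strategy linearD /= mulmxDl mxE. Qed.

Lemma strategyZ c v t : strategy (c *: v) t = c * strategy v t.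
Proof. by rewrite /strategy linearZ /= -scalemxAl mxE. Qed.

Lemma strategyB v w t : strategy (v - w) t = strategy v t - strategy w t.
Proof. by rewrite -scaleN1r strategyD strategyZ mulN1r. Qed.

Lemma strategy_const (c t : R) :
  strategy (\col_k (if k == 0 then c else 0) : 'cV_d.+1) t = c.
Proof.
rewrite strategyE (bigD1 0) //= mxE eqxx expr0 mulr1.
rewrite big1 ?addr0 // => k /negbTE k0.
by rewrite mxE k0 mul0r.
Qed.

Lemma strategy_cont v : continuous (strategy v).
Proof.
have -> : strategy v = fun t => \sum_k v k 0 * t ^+ k.
  by apply/funext => t; rewrite strategyE.
move=> t; apply: cvg_big => [|k _]; first exact: add_continuous.
apply: cvgM; first exact: cvg_cst.
exact: exprn_continuous.
Qed.

Lemma strategy_le v t : `|strategy v t| <= `|v| * \sum_(k < d.+1) `|t| ^+ k.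
Proof.
rewrite strategyE mulr_sumr; apply: le_trans (ler_norm_sum _ _ _) _.
apply: ler_sum => k _; rewrite normrM normrX ler_wpM2r ?exprn_ge0 //.
rewrite [leRHS]mx_normrE.
exact: (le_bigmax _ (fun ij => `|v ij.1 ij.2|) (k, 0)).
Qed.

(** A polynomial of degree d is determined by, and depends linearly on, its
    values at d+1 equally spaced points of the interval. *)
Lemma coef_bound (lo hi C : R) : lo < hi ->
  exists B, forall v, (forall t, t \in `[lo, hi] -> `|strategy v t| <= C) ->
    forall k, `|v k 0| <= B.
Proof.
move=> lohi.
pose s (j : 'I_d.+1) : R := lo + (hi - lo) * (j%:R / d.+1%:R).
have s_in j : s j \in `[lo, hi].
  have /andP[j0 j1] : 0 <= (j%:R / d.+1%:R : R) <= 1.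
    by rewrite divr_ge0 //= ler_pdivrMr // mul1r ler_nat ltnW.
  rewrite in_itv /= /s lerDl mulr_ge0 ?subr_ge0 ?(ltW lohi) //=.
  by rewrite -lerBrDl ler_piMr // subr_ge0 ltW.
pose a : 'rV[R]_d.+1 := \row_j s j.
have Vu : Vandermonde d.+1 a \in unitmx.
  rewrite unitmxE det_Vandermonde unitfE; apply/prodf_neq0 => i _.
  apply/prodf_neq0 => j ij; rewrite !mxE /s subr_eq0 (inj_eq (addrI _)).
  rewrite (inj_eq (mulfI _)); last by rewrite subr_eq0 gt_eqF.
  rewrite (inj_eq (divIf _)) ?pnatr_eq0 // eqr_nat.
  by rewrite gtn_eqF.
(* The sum over k only serves to make the bound uniform in k. *)
exists (C * \sum_k \sum_j `|invmx (Vandermonde d.+1 a) j k|) => v hv k.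
(* The coefficients are the values at the nodes times the inverse of a
   Vandermonde matrix. *)
have vE : v^T = (\row_j strategy v (s j)) *m invmx (Vandermonde d.+1 a).
  apply: (canRL (mulmxK Vu)); apply/rowP => j; rewrite !mxE strategyE.
  by apply: eq_bigr => l _; rewrite !mxE.
have -> : v k 0 = v^T 0 k by rewrite mxE.
have C0 : 0 <= C by apply: le_trans (hv (s ord0) (s_in _)).
rewrite vE mxE; apply: le_trans (ler_norm_sum _ _ _) _.
rewrite [X in _ <= C * X](bigD1 k) //= mulrDr -[leLHS]addr0 lerD //; last first.
  by rewrite mulr_ge0 // sumr_ge0 // => l _; apply: sumr_ge0.
rewrite mulr_sumr; apply: ler_sum => j _; rewrite normrM ler_wpM2r //.
by rewrite mxE hv.
Qed.

End Strategies.

(** * Expected utilities *)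

Section Payoffs.
Context {R : realType} {n : nat}.
Variables (tlo thi alo ahi : 'I_n -> R).
Variables (u : 'I_n -> 'rV[R]_n -> 'rV[R]_n -> R)
  (eta : probability (borel_rV R n) R).
Hypothesis eta_Theta : eta (box tlo thi) = 1%E.
Hypothesis u_cont : forall i, {within box alo ahi `*` box tlo thi,
  continuous (fun p : 'rV[R]_n * 'rV[R]_n => u i p.1 p.2)}.
Hypothesis u_concave : forall i a theta, box alo ahi a -> box tlo thi theta ->
  @concave_function R R^o `[alo i, ahi i] (fun x => u i (deviate i x a) theta).
Context {d : nat}.
Implicit Types (V W : 'I_n -> 'cV[R]_d.+1).

Local Notation Theta := (box tlo thi).
Local Notation adm := (admissible tlo thi alo ahi (d:=d)).

Definition play i W V (theta : 'rV[R]_n) : 'rV[R]_n :=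
  deviate i (strategy (W i) (theta 0 i)) (actions V theta).

(** The real-valued counterpart of [expected_utility], for which the order and
    arithmetic of the reals are available (see [expected_utilityE]). *)
Definition payoff i W V : R :=
  \int[eta]_(theta in Theta) u i (play i W V theta) theta.

Let eta_fin : (eta Theta < +oo)%E.
Proof. by rewrite eta_Theta ltry. Qed.

Lemma playE i W V theta j :
  play i W V theta 0 j = strategy (if j == i then W j else V j) (theta 0 j).
Proof. by rewrite !mxE; case: eqVneq => // ->. Qed.

Lemma play_box i W V theta : adm W -> adm V -> Theta theta ->
  box alo ahi (play i W V theta).
Proof.
move=> aW aV th j; rewrite playE in_itv /=.
by case: eqP => _; [apply: aW|apply: aV].
Qed.

Lemma play_cont i W V : continuous (play i W V).
Proof.
move=> theta; apply/(cvg_ballP (FF := nbhs_filter theta)) => e e0.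
suff : \forall y \near theta, forall j,
    `|play i W V theta 0 j - play i W V y 0 j| < e.
  apply: filterS => y h; split => // i' j.
  by rewrite ord1 -ball_normE; exact: h.
apply: (filter_forall (nbhs_filter theta)) => j.
have h : (fun y => play i W V y 0 j) @ theta --> play i W V theta 0 j.
  rewrite playE (_ : (fun y => _) =
    strategy (if j == i then W j else V j) \o (fun y : 'rV_n => y 0 j)).
    by apply: continuous_comp; [exact: coord_continuous|exact: strategy_cont].
  by apply/funext => y; rewrite playE.
exact: ((cvgrPdist_lt (FF := nbhs_filter theta) _ _).1 h e e0).
Qed.

Lemma integrand_cont i W V : adm W -> adm V ->
  {within Theta, continuous (fun theta => u i (play i W V theta) theta)}.
Proof.
move=> aW aV; apply/subspace_continuousP => x Tx.
have /subspace_continuousP/(_ (play i W V x, x)) := @u_cont i.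
move=> /(_ (conj (play_box i aW aV Tx) Tx)) h.
have : (fun theta => (play i W V theta, theta)) @ within Theta (nbhs x) -->
    within (box alo ahi `*` Theta) (nbhs (play i W V x, x)).
  move=> P; rewrite /within /= => hP.
  have : (fun theta => (play i W V theta, theta)) @ x --> (play i W V x, x).
    exact: (cvg_pair (@play_cont i W V x) (@cvg_id _ (nbhs x))).
  move=> /(_ _ hP); apply: (@filterS _ (nbhs x) (nbhs_filter x)).
  move=> theta /= h' Tt; apply: h'; split=> //=.
  exact: play_box.
by move=> h'; apply: cvg_comp h' h.
Qed.

Lemma integrand_integrable i W V : adm W -> adm V ->
  eta.-integrable Theta
    (EFin \o (fun theta => u i (play i W V theta) theta)).
Proof.
move=> aW aV; have mT := box_measurable tlo thi.
apply: measurable_bounded_integrable => //.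
- apply: within_continuous_measurable => //; exact: integrand_cont.
- have : compact ((fun theta => u i (play i W V theta) theta) @` Theta).
    by apply: continuous_compact; [exact: integrand_cont|exact: box_compact].
  move=> /compact_bounded[M [Mr hM]]; exists M; split=> // x /hM h theta Tt.
  by apply: h; exists theta.
Qed.

(** The integral is finite because the integrand is bounded: it is continuous
    on the compact set Theta. *)
Lemma expected_utilityE i W V : adm W -> adm V ->
  expected_utility eta Theta u V i (W i) = (payoff i W V)%:E.
Proof.
move=> aW aV; rewrite /expected_utility unlock /payoff /Rintegral fineK.
  rewrite [RHS]integral_mkcond; apply: eq_integral => theta _.
  by rewrite !patchE; case: ifP.
apply: integrable_fin_num; [exact: box_measurable|exact: integrand_integrable].
Qed.

(** Uniform continuity of u i on A x Theta, integrated against a probability. *)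
Lemma payoff_unif i (e : R) : 0 < e -> exists2 r : R, 0 < r &
  forall W V W' V', adm W -> adm V -> adm W' -> adm V' ->
    (forall j t, t \in `[tlo j, thi j] ->
      `|strategy (W j) t - strategy (W' j) t| < r /\
      `|strategy (V j) t - strategy (V' j) t| < r) ->
  `|payoff i W V - payoff i W' V'| <= e.
Proof.
move=> e0; have mT := box_measurable tlo thi.
have cAT : compact (box alo ahi `*` Theta).
  by apply: compact_setX; exact: box_compact.
have := compact_unif_continuous cAT (u_cont (i:=i)) e0.
move=> h; have [r [r0 hr]] := filter_ex (filterI (@nbhs_right_gt R 0) h).
exists r => // W V W' V' aW aV aW' aV' close.
have I1 := integrand_integrable i aW aV.
have I2 := integrand_integrable i aW' aV'.
rewrite /payoff -RintegralB //.
have I12 : eta.-integrable Theta (EFin \o (fun theta =>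
    u i (play i W V theta) theta - u i (play i W' V' theta) theta)).
  under [X in _.-integrable _ X]eq_fun do rewrite /= EFinB.
  exact: integrableB.
apply: le_trans (le_normr_Rintegral _ I12) _ => //.
have <- : \int[eta]_(_ in Theta) e = e.
  by rewrite Rintegral_cst // [X in _ * fine X]eta_Theta mulr1.
apply: le_Rintegral => //.
- exact: (integrable_norm I12).
- apply: measurable_bounded_integrable => //.
  by exists `|e|; split => // x xe theta _ /=; exact: ltW.
- move=> theta Tt; apply/ltW.
  apply: (hr (play i W V theta, theta) (play i W' V' theta, theta)).
  + by split => //; exact: play_box.
  + by split => //; exact: play_box.
  split; last exact: ballxx.
  split=> // i' j; rewrite ord1 -ball_normE /= !playE.
  by have [hW hV] := close j _ (Tt j); case: ifP.
Qed.

Lemma payoff_concave i W1 W2 V (p : R) : 0 <= p -> p <= 1 ->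
  adm W1 -> adm W2 -> adm V ->
  adm (fun j => p *: W1 j + (1 - p) *: W2 j) ->
  p * payoff i W1 V + (1 - p) * payoff i W2 V <=
  payoff i (fun j => p *: W1 j + (1 - p) *: W2 j) V.
Proof.
move=> p0 p1 a1 a2 aV a12; have mT := box_measurable tlo thi.
have I1 := integrand_integrable i a1 aV.
have I2 := integrand_integrable i a2 aV.
have I12 := integrand_integrable i a12 aV.
have J1 := integrableZl mT p I1.
have J2 := integrableZl mT (1 - p) I2.
rewrite /payoff -!RintegralZl // -RintegralD //.
apply: le_Rintegral => //.
  under [X in _.-integrable _ X]eq_fun do rewrite /= EFinD.
  exact: integrableD.
move=> theta Tt.
have aT : box alo ahi (actions V theta).
  by move=> j; rewrite mxE in_itv; exact: aV.
have h1 : strategy (W1 i) (theta 0 i) \in `[alo i, ahi i]%classic.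
  by rewrite inE /= in_itv; exact: a1.
have h2 : strategy (W2 i) (theta 0 i) \in `[alo i, ahi i]%classic.
  by rewrite inE /= in_itv; exact: a2.
have := u_concave aT Tt (Itv01 p0 p1) h1 h2.
by rewrite /play strategyD !strategyZ.
Qed.

End Payoffs.

(** * A compact convex set of profiles *)

Section Coefficients.
Context {R : realType} {n d : nat}.
Implicit Types x y : 'rV[R]_(n * d.+1).

(** The coefficients of all players are stored in one row vector, a normed
    space in which closed bounded sets are compact. *)
Definition profile x (i : 'I_n) : 'cV[R]_d.+1 := \col_k x 0 (mxvec_index i k).

Definition coords (V : 'I_n -> 'cV[R]_d.+1) : 'rV[R]_(n * d.+1) :=
  mxvec (\matrix_(i, k) V i k 0).

Lemma coordsK V : profile (coords V) = V.
Proof.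
by apply/funext => i; apply/colP => k; rewrite mxE mxvecE mxE.
Qed.

Lemma profile_conv (p q : R) x y :
  profile (p *: x + q *: y) = fun i => p *: profile x i + q *: profile y i.
Proof. by apply/funext => i; apply/colP => k; rewrite !mxE. Qed.

Lemma profileB x y i : profile (x - y) i = profile x i - profile y i.
Proof. by apply/colP => k; rewrite !mxE. Qed.

Lemma profile_norm x i : `|profile x i| <= `|x|.
Proof.
rewrite [leLHS]mx_normrE; apply/bigmax_leP; split=> // -[k j] _ /=.
rewrite mxE [leRHS]mx_normrE.
exact: (le_bigmax _ (fun ij => `|x ij.1 ij.2|) (0, mxvec_index i k)).
Qed.

Lemma profile_bounded x M : 0 <= M ->
  (forall i k, `|profile x i k 0| <= M) -> `|x| <= M.
Proof.
move=> M0 h; rewrite [leLHS]mx_normrE; apply/bigmax_leP; split=> // -[i j] _ /=.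
by case/mxvec_indexP: j => j k; rewrite ord1; have := h j k; rewrite mxE.
Qed.

Lemma strategy_profile_cont i t :
  continuous (fun x => strategy (profile x i) t).
Proof.
have -> : (fun x => strategy (profile x i) t) =
    fun x => \sum_k x 0 (mxvec_index i k) * t ^+ k.
  by apply/funext => x; rewrite strategyE; apply: eq_bigr => k _; rewrite mxE.
apply: continuous_big => [|k _ x]; first exact: add_continuous.
exact: cvgM (@coord_continuous R _ _ 0 (mxvec_index i k) x) (cvg_cst _).
Qed.

End Coefficients.

Section Equilibrium.
Context {R : realType} {n : nat}.
Variables (tlo thi alo ahi : 'I_n -> R).
Hypothesis tlohi : forall i, tlo i <= thi i.
Hypothesis alohi : forall i, alo i <= ahi i.
Context {d : nat}.
Local Notation adm := (admissible tlo thi alo ahi (d:=d)).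

(** When Theta_i is a point, the condition on the coefficients of player i makes
    this set bounded; it keeps one representative of each strategy. *)
Definition reduced : set 'rV[R]_(n * d.+1) :=
  [set x | adm (profile x) /\
    forall i k, tlo i = thi i -> k != 0 -> profile x i k 0 = 0].

Lemma admissible_conv V W (p : R) : 0 <= p -> p <= 1 -> adm V -> adm W ->
  adm (fun i => p *: V i + (1 - p) *: W i).
Proof.
move=> p0 p1 aV aW i t ti; rewrite strategyD !strategyZ.
have /andP[v1 v2] := aV i t ti; have /andP[w1 w2] := aW i t ti.
by apply/andP; split; nra.
Qed.

Lemma reduced_convex : @convex_set R 'rV[R]_(n * d.+1) reduced.
Proof.
move=> x y p; rewrite !inE => -[ax zx] [ay zy]; rewrite /reduced /=.
have -> : profile (conv p x y : 'rV[R]_(n * d.+1)) =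
    fun i => p%:num *: profile x i + (1 - p%:num) *: profile y i.
  exact: profile_conv.
split; first by apply: admissible_conv.
by move=> i k it k0; rewrite !mxE; have := zx i k it k0; have := zy i k it k0;
  rewrite !mxE => -> ->; rewrite !mulr0 addr0.
Qed.

Lemma reduced_closed : closed reduced.
Proof.
have -> : reduced =
  (\bigcap_(p in [set p : 'I_n * R | p.2 \in `[tlo p.1, thi p.1]])
     (fun x => strategy (profile x p.1) p.2) @^-1` `[alo p.1, ahi p.1]) `&`
  (\bigcap_(p in [set p : 'I_n * 'I_d.+1 | tlo p.1 = thi p.1 /\ p.2 != 0])
     (fun x : 'rV[R]_(n * d.+1) => x 0 (mxvec_index p.1 p.2)) @^-1` [set 0]).
  apply/seteqP; split => x.
    move=> [ax zx]; split.
      by move=> [i t] /= ti; rewrite in_itv; exact: ax.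
    by move=> [i k] /= [it k0]; have := zx i k it k0; rewrite mxE.
  move=> [ax zx]; split.
    by move=> i t ti; have := ax (i, t) ti; rewrite /= in_itv.
  by move=> i k it k0; have := zx (i, k) (conj it k0); rewrite mxE.
apply: closedI; apply: closed_bigI => p _; apply: preimage_closed.
- by move=> x _; exact: strategy_profile_cont.
- exact: interval_closed.
- by move=> x _; exact: coord_continuous.
- exact: closed_eq.
Qed.

Lemma reduced_bounded : bounded_set reduced.
Proof.
pose C (i : 'I_n) := `|alo i| + `|ahi i|.
have valC x i t : reduced x -> t \in `[tlo i, thi i] ->
    `|strategy (profile x i) t| <= C i.
  move=> [ax _] ti; have /andP[h1 h2] := ax i t ti; rewrite /C.
  have := ler_norm (ahi i); have := ler_norm (- alo i); rewrite normrN.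
  have := normr_ge0 (alo i); have := normr_ge0 (ahi i).
  by rewrite ler_norml => *; apply/andP; split; lra.
have /choice[B hB] : forall i, exists B, forall x, reduced x ->
    forall k, `|profile x i k 0| <= B.
  move=> i; have := tlohi i; rewrite le_eqVlt => /predU1P[it|it].
    exists (C i) => x Rx k; have [->|k0] := eqVneq k 0; last first.
      have [_ /(_ i k it k0) ->] := Rx; rewrite normr0.
      by rewrite /C addr_ge0.
    have := valC x i (tlo i) Rx; rewrite in_itv /= lexx tlohi => /(_ isT).
    rewrite strategyE (bigD1 0) //= expr0 mulr1 big1 ?addr0 // => l l0.
    by have [_ /(_ i l it l0) ->] := Rx; rewrite mul0r.
  have [B hB] := @coef_bound R d _ _ (C i) it.
  by exists B => x Rx; apply: hB => t ti; exact: valC.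
pose M := \sum_i `|B i|.
have M0 : 0 <= M by apply: sumr_ge0.
exists M; split; first exact: num_real.
move=> M' MM' x Rx; apply: le_trans (ltW MM'); apply: profile_bounded => // i k.
apply: le_trans (hB i x Rx k) _; apply: le_trans (ler_norm _) _.
by rewrite /M (bigD1 i) //= lerDl sumr_ge0.
Qed.

Lemma reduced_compact : compact reduced.
Proof. exact: bounded_closed_compact reduced_bounded reduced_closed. Qed.

(** A polynomial is replaced by its value when Theta_i is a point. *)
Lemma admissible_reduce V : adm V -> exists2 x, reduced x &
  forall i t, t \in `[tlo i, thi i] ->
    strategy (profile x i) t = strategy (V i) t.
Proof.
move=> aV.
pose W i : 'cV[R]_d.+1 := if tlo i == thi i
  then \col_k (if k == 0 then strategy (V i) (tlo i) else 0) else V i.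
have WV i t : t \in `[tlo i, thi i] -> strategy (W i) t = strategy (V i) t.
  rewrite /W; case: eqP => // it; rewrite in_itv /= -it => /le_anti ->.
  exact: strategy_const.
exists (coords W); rewrite ?coordsK //; split; rewrite coordsK.
  by move=> i t ti; rewrite WV //; exact: aV.
by move=> i k it k0; rewrite /W it eqxx mxE (negbTE k0).
Qed.

Lemma reduced_nonempty : reduced !=set0.
Proof.
pose V i : 'cV[R]_d.+1 := \col_k (if k == 0 then alo i else 0).
have [|x Rx _] := @admissible_reduce V; last by exists x.
by move=> i t _; rewrite strategy_const lexx alohi.
Qed.

Lemma strategy_profile_close : exists2 B : R, 0 < B &
  forall (x y : 'rV[R]_(n * d.+1)) i t,
  t \in `[tlo i, thi i] ->
  `|strategy (profile x i) t - strategy (profile y i) t| <= `|x - y| * B.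
Proof.
pose T i := `|tlo i| + `|thi i|.
pose B := \sum_i \sum_(k < d.+1) T i ^+ k.
have T0 i : 0 <= T i by rewrite addr_ge0.
have B0 : 0 <= B by do 2 (apply: sumr_ge0 => ? _); rewrite exprn_ge0.
exists (B + 1); first by rewrite ltr_wpDl.
move=> x y i t ti; rewrite -strategyB -profileB.
apply: le_trans (strategy_le _ _) _; apply: ler_pM => //.
- by apply: sumr_ge0 => k _; rewrite exprn_ge0.
- exact: profile_norm.
apply: (@le_trans _ _ B); last by rewrite lerDl.
rewrite /B (bigD1 i) //= -[leLHS]addr0 lerD //; last first.
  by do 2 (apply: sumr_ge0 => ? _); rewrite exprn_ge0.
apply: ler_sum => k _; apply: lerXn2r; rewrite ?nnegrE //.
move: ti; rewrite in_itv /= => /andP[t1 t2]; rewrite /T.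
have := ler_norm (thi i); have := ler_norm (- tlo i); rewrite normrN.
have := normr_ge0 (tlo i); have := normr_ge0 (thi i).
by rewrite ler_norml => *; apply/andP; split; lra.
Qed.

(** * The Nikaido-Isoda function *)

Variables (u : 'I_n -> 'rV[R]_n -> 'rV[R]_n -> R)
  (eta : probability (borel_rV R n) R).
Hypothesis eta_Theta : eta (box tlo thi) = 1%E.
Hypothesis u_cont : forall i, {within box alo ahi `*` box tlo thi,
  continuous (fun p : 'rV[R]_n * 'rV[R]_n => u i p.1 p.2)}.
Hypothesis u_concave : forall i a theta, box alo ahi a -> box tlo thi theta ->
  @concave_function R R^o `[alo i, ahi i] (fun x => u i (deviate i x a) theta).

Local Notation J := (payoff tlo thi u eta).

(** Used with phi constant, for a fixed deviation, and with phi the identity,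
    for the payoff of the profile itself. *)
Lemma payoff_within_cont i
    (phi : 'rV[R]_(n * d.+1) -> 'rV[R]_(n * d.+1)) :
  (forall x, reduced x -> reduced (phi x)) ->
  (forall x y, `|phi x - phi y| <= `|x - y|) ->
  {within reduced, continuous (fun x => J i (profile (phi x)) (profile x))}.
Proof.
move=> Rphi phi_le; apply/subspace_continuousP => x Rx.
apply/cvgrPdist_le => e e0.
have [r r0 hr] := payoff_unif eta_Theta u_cont (d := d) i e0.
have [B B0 hB] := strategy_profile_close.
rewrite near_withinE; near=> y => Ry.
have xy : `|x - y| * B < r.
  rewrite -ltr_pdivlMr //; near: y.
  by apply: cvgr_dist_lt => //; rewrite divr_gt0.
apply: hr;
  [exact: (Rphi x Rx).1|exact: Rx.1|exact: (Rphi y Ry).1|exact: Ry.1|].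
move=> j t tj; split; apply: le_lt_trans (hB _ _ _ _ tj) _ => //.
by apply: le_lt_trans xy; rewrite ler_wpM2r // ltW.
Unshelve. all: by end_near. Qed.

Definition gain (W V : 'rV[R]_(n * d.+1)) : R :=
  \sum_i (J i (profile W) (profile V) - J i (profile V) (profile V)).

Lemma gain_cont W : reduced W -> {within reduced, continuous gain W}.
Proof.
move=> RW; apply/subspace_continuousP => V RV.
apply: cvg_big => [|i _]; first exact: add_continuous.
have c1 : {within reduced, continuous fun x => J i (profile W) (profile x)}.
  by apply: (@payoff_within_cont i (fun=> W)) => // x y; rewrite subrr normr0.
have c2 : {within reduced, continuous fun x => J i (profile x) (profile x)}.
  exact: (@payoff_within_cont i id).
by apply: cvgB;
  [move/subspace_continuousP: c1|move/subspace_continuousP: c2]; apply.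
Qed.

Lemma gain_quasiconcave V (c : R) : reduced V ->
  @convex_set R 'rV[R]_(n * d.+1) [set W | reduced W /\ c <= gain W V].
Proof.
move=> RV W1 W2 p; rewrite !inE => -[R1 c1] [R2 c2].
have RW : reduced (conv p W1 W2 : 'rV[R]_(n * d.+1)).
  by apply: set_mem; apply: reduced_convex; rewrite inE.
split=> //; have p0 : 0 <= p%:num by []; have p1 : p%:num <= 1 by [].
have pE : profile (conv p W1 W2 : 'rV[R]_(n * d.+1)) =
    fun i => p%:num *: profile W1 i + (1 - p%:num) *: profile W2 i.
  exact: profile_conv.
apply: (@le_trans _ _ (p%:num * gain W1 V + (1 - p%:num) * gain W2 V)).
  by nra.
rewrite /gain !mulr_sumr -big_split; apply: ler_sum => i _ /=.
have ac := admissible_conv p0 p1 R1.1 R2.1.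
have := payoff_concave
  eta_Theta u_cont u_concave i p0 p1 R1.1 R2.1 RV.1 ac.
by rewrite pE; lra.
Qed.

End Equilibrium.

(** * Existence of an equilibrium *)

Theorem theorem4p2 (R : realType) (n : nat)
    (tlo thi alo ahi : 'I_n -> R)
    (tlohi : forall i, tlo i <= thi i) (alohi : forall i, alo i <= ahi i)
    (u : 'I_n -> 'rV[R]_n -> 'rV[R]_n -> R)
    (eta : probability (borel_rV R n) R)
    (eta_Theta : eta (box tlo thi) = 1%E)
    (u_cont : forall i, {within box alo ahi `*` box tlo thi,
        continuous (fun p : 'rV[R]_n * 'rV[R]_n => u i p.1 p.2)})
    (u_concave : forall i a theta, box alo ahi a -> box tlo thi theta ->
        @concave_function R R^o `[alo i, ahi i]
          (fun x => u i (deviate i x a) theta))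
    (d : nat) :
  exists Vs : 'I_n -> 'cV[R]_d.+1,
    argmax (@admissible R n tlo thi alo ahi d)
      (fun V => (\sum_(i < n)
         expected_utility eta (box tlo thi) u Vs i (V i))%E) Vs.
Proof.
have K_compact := @reduced_compact R n tlo thi alo ahi tlohi d.
have K_convex := @reduced_convex R n tlo thi alo ahi d.
have K_nonempty := @reduced_nonempty R n tlo thi alo ahi alohi d.
have gain_c := @gain_cont R n tlo thi alo ahi d u eta eta_Theta u_cont.
have gain_qc :=
  @gain_quasiconcave R n tlo thi alo ahi d u eta eta_Theta u_cont u_concave.
have [|V RV hV] := ky_fan K_compact K_convex gain_c gain_qc _ K_nonempty.
  by move=> V _; rewrite /gain big1 // => i _; rewrite subrr.
exists (profile V); split => [|W aW]; first exact: RV.1.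
have [W' RW' W'E] := admissible_reduce aW.
under eq_bigr do rewrite (expected_utilityE eta_Theta u_cont _ aW RV.1).
under [leRHS]eq_bigr do
  rewrite (expected_utilityE eta_Theta u_cont _ RV.1 RV.1).
rewrite !sumEFin lee_fin -subr_le0 -sumrB; apply: le_trans (hV W' RW').
(* W and its reduced form W' prescribe the same actions on Theta. *)
rewrite le_eqVlt; apply/orP; left; apply/eqP/eq_bigr => i _; congr (_ - _).
apply: eq_Rintegral => theta; rewrite inE => Tt; congr u.
by apply/rowP => j; rewrite !playE; case: eqP => // _; rewrite W'E.
Qed.
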